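(* Let $\mathbf{s}\in\mathcal{S}(m|n)$. Every finite-dimensional irreducible representation of $\mathrm{U}_q(\widehat{\mathfrak{g}}_{\mathbf{s}})$ is a highest weight representation.
   Context: $q\in\mathbb{C}\setminus\{0\}$ is not a root of unity; $m,n\in\mathbb{Z}_{\ge0}$, $N=m+n\ge2$. $\mathcal{S}(m|n)$ is the set of sequences $\mathbf{s}=s_1\cdots s_N$ with exactly $m$ zeros and $n$ ones. Given $\mathbf{s}$: $|i|=\bar0$, $d_i=1$ if $s_i=0$, and $|i|=\bar1$, $d_i=-1$ if $s_i=1$; $q_i=q^{d_i}$; $\varsigma_{ab;cd}=(-1)^{(|a|+|b|)(|c|+|d|)}$; $\delta_{\mathrm{cond}}$ is $1$ if the condition holds and $0$ otherwise. The quantum affine general linear superalgebra $\mathrm{U}_q(\widehat{\mathfrak{g}}_{\mathbf{s}})$ is the associative superalgebra over $\mathbb{C}$ generated by $t_{ij}^{(r)},\bar t_{ij}^{(r)}$ ($1\le i,j\le N$, $r\in\mathbb{Z}_{\ge0}$), of parity $|i|+|j|$. With $t_{ij}(u)=\sum_{r\ge0}t_{ij}^{(r)}u^{-r}$, $\bar t_{ij}(u)=\sum_{r\ge0}\bar t_{ij}^{(r)}u^r$, the defining relations are: $t_{ij}^{(0)}=\bar t_{ji}^{(0)}=0$ for $i<j$; $t_{ii}^{(0)}\bar t_{ii}^{(0)}=\bar t_{ii}^{(0)}t_{ii}^{(0)}=1$; and, for each of $(\gamma,\gamma')=(t,t),(\bar t,\bar t),(t,\bar t)$ and all $i,j,k,l$,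 $$(q_i^{-\delta_{ik}}v-q_i^{\delta_{ik}}u)\gamma_{ij}(u)\gamma'_{kl}(v)-\varsigma_{ij;kl}(q_j^{-\delta_{jl}}v-q_j^{\delta_{jl}}u)\gamma'_{kl}(v)\gamma_{ij}(u)$$ $$=\varsigma_{ik;kl}(q_k-q_k^{-1})\Big((\delta_{k<i}u+\delta_{i<k}v)\gamma_{kj}(u)\gamma'_{il}(v)-(\delta_{j<l}u+\delta_{l<j}v)\gamma'_{kj}(v)\gamma_{il}(u)\Big).$$ A representation $V$ is a highest weight representation if it is generated by a nonzero vector $\zeta$ such that $t_{ij}(u)\zeta=\bar t_{ij}(u)\zeta=0$ for $1\le i<j\le N$ and $t_{ii}(u)\zeta=\lambda_i(u)\zeta$, $\bar t_{ii}(u)\zeta=\bar\lambda_i(u)\zeta$ for all $i$, where $\lambda_i(u)=\sum_{r\ge0}\lambda_i^{(r)}u^{-r}$, $\bar\lambda_i(u)=\sum_{r\ge0}\bar\lambda_i^{(r)}u^r$ have complex coefficients with $\lambda_i^{(0)}\bar\lambda_i^{(0)}=1$. *)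

(* Defs.v *)
From HB Require Import structures.
From mathcomp Require Import all_boot all_order all_algebra.
From mathcomp Require Import boolp reals complex.
From mathcomp Require Import monalg.

Set Implicit Arguments.
Unset Strict Implicit.
Unset Printing Implicit Defensive.

Import GRing.Theory.
Local Open Scope ring_scope.
Local Open Scope quotient_scope.

Section IdealQuotient.
Variables (C : comNzRingType) (A : lalgType C) (rel : A -> Prop).

(* The two-sided ideal generated by rel; it is closed under opposites and
   scalars because - x = (- 1) * x and c *: x = (c *: 1) * x. *)
Inductive in_ideal : A -> Prop :=
| ideal_gen x of rel x : in_ideal x
| ideal_0 : in_ideal 0
| ideal_D x y of in_ideal x & in_ideal y : in_ideal (x + y)
| ideal_Ml x y of in_ideal y : in_ideal (x * y)
| ideal_Mr x y of in_ideal x : in_ideal (x * y).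

Definition ideal_equiv (x y : A) : bool := `[< in_ideal (x - y) >].

Lemma ideal_N x : in_ideal x -> in_ideal (- x).
Proof. by move=> Ix; rewrite -mulN1r; apply: ideal_Ml. Qed.

Lemma ideal_equivP x y : reflect (in_ideal (x - y)) (ideal_equiv x y).
Proof. exact: asboolP. Qed.

Lemma ideal_equiv_is_equiv : equiv_class_of ideal_equiv.
Proof.
split=> [x|x y|y x z].
- by apply/ideal_equivP; rewrite subrr; apply: ideal_0.
- by apply/ideal_equivP/ideal_equivP=> /ideal_N; rewrite opprB.
- move=> /ideal_equivP xy /ideal_equivP yz; apply/ideal_equivP.
  by rewrite -(subrKA y); apply: ideal_D.
Qed.

Canonical ideal_equiv_equiv := EquivRelPack ideal_equiv_is_equiv.

Definition quot_alg := {eq_quot ideal_equiv}.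

HB.instance Definition _ := Choice.on quot_alg.
HB.instance Definition _ := EqQuotient.on quot_alg.

Definition to_quot (x : A) : quot_alg := \pi_quot_alg x.

Lemma to_quotP x y : to_quot x = to_quot y <-> in_ideal (x - y).
Proof.
split=> [/eqP|h]; first by rewrite /to_quot eqmodE => /ideal_equivP.
by apply/eqP; rewrite /to_quot eqmodE; apply/ideal_equivP.
Qed.

Lemma to_quot_repr x : to_quot (repr x) = x.
Proof. by rewrite /to_quot reprK. Qed.

Lemma repr_to_quot x : in_ideal (repr (to_quot x) - x).
Proof. by apply/to_quotP; rewrite to_quot_repr. Qed.

Definition quot_add (x y : quot_alg) := to_quot (repr x + repr y).
Definition quot_opp (x : quot_alg) := to_quot (- repr x).
Definition quot_mul (x y : quot_alg) := to_quot (repr x * repr y).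
Definition quot_scale (c : C) (x : quot_alg) := to_quot (c *: repr x).

Lemma to_quot_add x y : quot_add (to_quot x) (to_quot y) = to_quot (x + y).
Proof.
apply/to_quotP; rewrite opprD addrACA.
by apply: ideal_D; apply: repr_to_quot.
Qed.

Lemma to_quot_opp x : quot_opp (to_quot x) = to_quot (- x).
Proof. by apply/to_quotP; rewrite -opprD; apply/ideal_N/repr_to_quot. Qed.

Lemma to_quot_mul x y : quot_mul (to_quot x) (to_quot y) = to_quot (x * y).
Proof.
apply/to_quotP; set x' := repr _; set y' := repr _.
have -> : x' * y' - x * y = (x' - x) * y' + x * (y' - y).
  by rewrite mulrBl mulrBr addrA subrK.
by apply: ideal_D; [apply: ideal_Mr|apply: ideal_Ml]; apply: repr_to_quot.
Qed.

Lemma to_quot_scale c x : quot_scale c (to_quot x) = to_quot (c *: x).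
Proof.
apply/to_quotP; rewrite -scalerBr -[X in c *: X]mul1r scalerAl.
exact/ideal_Ml/repr_to_quot.
Qed.

Let quotE := (to_quot_add, to_quot_opp, to_quot_mul, to_quot_scale).

Lemma quot_ind (P : quot_alg -> Prop) : (forall x, P (to_quot x)) -> forall x, P x.
Proof. by move=> Pq x; rewrite -(to_quot_repr x). Qed.

Fact quot_addA : associative quot_add.
Proof. by do 3!elim/quot_ind=> ?; rewrite !quotE addrA. Qed.
Fact quot_addC : commutative quot_add.
Proof. by do 2!elim/quot_ind=> ?; rewrite !quotE addrC. Qed.
Fact quot_add0 : left_id (to_quot 0) quot_add.
Proof. by elim/quot_ind=> ?; rewrite !quotE add0r. Qed.
Fact quot_addN : left_inverse (to_quot 0) quot_opp quot_add.
Proof. by elim/quot_ind=> ?; rewrite !quotE addNr. Qed.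

HB.instance Definition _ :=
  GRing.isZmodule.Build quot_alg quot_addA quot_addC quot_add0 quot_addN.

Fact quot_mulA : associative quot_mul.
Proof. by do 3!elim/quot_ind=> ?; rewrite !quotE mulrA. Qed.
Fact quot_mul1 : left_id (to_quot 1) quot_mul.
Proof. by elim/quot_ind=> ?; rewrite !quotE mul1r. Qed.
Fact quot_mulr1 : right_id (to_quot 1) quot_mul.
Proof. by elim/quot_ind=> ?; rewrite !quotE mulr1. Qed.
Fact quot_mulDl : left_distributive quot_mul +%R.
Proof.
by do 3!elim/quot_ind=> ?; rewrite /GRing.add /= !quotE mulrDl.
Qed.
Fact quot_mulDr : right_distributive quot_mul +%R.
Proof.
by do 3!elim/quot_ind=> ?; rewrite /GRing.add /= !quotE mulrDr.
Qed.

HB.instance Definition _ := GRing.Zmodule_isPzRing.Build quot_alg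
  quot_mulA quot_mul1 quot_mulr1 quot_mulDl quot_mulDr.

Fact quot_scaleA a b v :
  quot_scale a (quot_scale b v) = quot_scale (a * b) v.
Proof. by elim/quot_ind: v => ?; rewrite !quotE scalerA. Qed.
Fact quot_scale1 : left_id 1 quot_scale.
Proof. by elim/quot_ind=> ?; rewrite !quotE scale1r. Qed.
Fact quot_scaleDr : right_distributive quot_scale +%R.
Proof.
by move=> c; do 2!elim/quot_ind=> ?; rewrite /GRing.add /= !quotE scalerDr.
Qed.
Fact quot_scaleDl v : {morph quot_scale^~ v : a b / a + b}.
Proof.
by move=> a b; elim/quot_ind: v => ?; rewrite [RHS]/GRing.add /= !quotE scalerDl.
Qed.

HB.instance Definition _ := GRing.Zmodule_isLmodule.Build C quot_alg
  quot_scaleA quot_scale1 quot_scaleDr quot_scaleDl.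

Lemma to_quotD x y : to_quot (x + y) = to_quot x + to_quot y.
Proof. by rewrite -to_quot_add. Qed.
Lemma to_quotM x y : to_quot (x * y) = to_quot x * to_quot y.
Proof. by rewrite -to_quot_mul. Qed.
Lemma to_quotZ c x : to_quot (c *: x) = c *: to_quot x.
Proof. by rewrite -to_quot_scale. Qed.
Lemma to_quot1 : to_quot 1 = 1. Proof. reflexivity. Qed.
Lemma to_quot0 : to_quot 0 = 0. Proof. reflexivity. Qed.
Lemma to_quotB x y : to_quot (x - y) = to_quot x - to_quot y.
Proof. by rewrite to_quotD -to_quot_opp. Qed.

Lemma quot_scaleAl (c : C) (x y : quot_alg) : c *: (x * y) = (c *: x) * y.
Proof.
elim/quot_ind: x => x; elim/quot_ind: y => y.
by rewrite -to_quotM -!to_quotZ -to_quotM scalerAl.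
Qed.

End IdealQuotient.

Section Relations.
Variables (C : fieldType) (N : nat) (s : N.-tuple bool) (q : C).
Implicit Types (i j k l : 'I_N) (a b : int) (r : nat).

Local Notation par i := (tnth s i).

Definition qi i : C := q ^ (if par i then - 1 else 1 : int).

Definition sg i j k l : C :=
  (-1) ^+ ((par i (+) par j) && (par k (+) par l)).

(* X false i j r stands for t_ij^(r), and X true i j r for tbar_ij^(r). *)
Variables (A : lalgType C) (X : bool -> 'I_N -> 'I_N -> nat -> A).

(* Formal distributions: S a is the coefficient of u^a in S(u), and P a b that
   of u^a v^b in P(u, v). *)
Definition series : Type := int -> A.
Definition series2 : Type := int -> int -> A.

Definition gen_series (g : bool) i j : series := fun a =>
  if g then (if 0 <= a then X true i j `|a|%N else 0)
  else (if a <= 0 then X false i j `|a|%N else 0).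

(* S(u) T(v) and T(v) S(u) *)
Definition prod_uv (S T : series) : series2 := fun a b => S a * T b.
Definition prod_vu (T S : series) : series2 := fun a b => T b * S a.

(* (x u + y v) P(u, v) *)
Definition lin_mul (x y : C) (P : series2) : series2 :=
  fun a b => x *: P (a - 1) b + y *: P a (b - 1).

Definition rtt_lhs (g g' : bool) i j k l : series2 := fun a b =>
  lin_mul (- qi i ^+ (i == k)) (qi i ^- (i == k))
    (prod_uv (gen_series g i j) (gen_series g' k l)) a b
  - sg i j k l *:
    lin_mul (- qi j ^+ (j == l)) (qi j ^- (j == l))
      (prod_vu (gen_series g' k l) (gen_series g i j)) a b.

Definition rtt_rhs (g g' : bool) i j k l : series2 := fun a b =>
  (sg i k k l * (qi k - (qi k)^-1)) *:
    (lin_mul (k < i)%N%:R (i < k)%N%:R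
       (prod_uv (gen_series g k j) (gen_series g' i l)) a b
     - lin_mul (j < l)%N%:R (l < j)%N%:R
       (prod_vu (gen_series g' k j) (gen_series g i l)) a b).

(* The elements that the defining relations set to zero. *)
Inductive relator : A -> Prop :=
| rel_t0 i j of (i < j)%N : relator (X false i j 0)
| rel_tbar0 i j of (i < j)%N : relator (X true j i 0)
| rel_inv_r i : relator (X false i i 0 * X true i i 0 - 1)
| rel_inv_l i : relator (X true i i 0 * X false i i 0 - 1)
| rel_rtt (g g' : bool) i j k l a b of
    (g, g') \in [:: (false, false); (true, true); (false, true)] :
    relator (rtt_lhs g g' i j k l a b - rtt_rhs g g' i j k l a b).

(* The trivial representation X g i j r |-> delta_ij delta_r0 satisfies the
   relations; this is used to show that Uq is a nonzero ring. *)
Section Counit.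
Variable f : A -> C.
Hypotheses (fZ : forall c, {morph f : x / c *: x >-> c * x})
  (fB : {morph f : x y / x - y}) (fM : {morph f : x y / x * y}) (f1 : f 1 = 1)
  (fX : forall g i j r, f (X g i j r) = ((i == j) && (r == 0%N))%:R).

Let f0 : f 0 = 0. Proof. by rewrite -[0](subrr 0) fB subrr. Qed.
Let fD : {morph f : x y / x + y}.
Proof. by move=> x y; rewrite -[y in LHS]opprK -[- y]sub0r !fB f0 sub0r opprK. Qed.

Lemma counit_series g i j a :
  f (gen_series g i j a) = ((i == j) && (a == 0))%:R.
Proof.
rewrite /gen_series; case: g; case: ifP => [_|/negbT]; rewrite ?fX ?absz_eq0 //;
  by rewrite f0; case: (a =P 0) => [->|_]; rewrite ?andbF.
Qed.

Lemma counit_lin (x y : C) P a b :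
  f (lin_mul x y P a b) = x * f (P (a - 1) b) + y * f (P a (b - 1)).
Proof. by rewrite /lin_mul fD !fZ. Qed.

Lemma counit_uv S T a b : f (prod_uv S T a b) = f (S a) * f (T b).
Proof. exact: fM. Qed.
Lemma counit_vu S T a b : f (prod_vu T S a b) = f (S a) * f (T b).
Proof. by rewrite mulrC; exact: fM. Qed.

Lemma counit_relator x : relator x -> f x = 0.
Proof.
case=> [i j ij|i j ij|i|i|g g' i j k l a b _].
- by rewrite fX -val_eqE (ltn_eqF ij).
- by rewrite fX -val_eqE (gtn_eqF ij).
- by rewrite fB fM f1 !fX !eqxx mulr1 subrr.
- by rewrite fB fM f1 !fX !eqxx mulr1 subrr.
rewrite /rtt_lhs /rtt_rhs !(fB, fZ) !counit_lin !(counit_uv, counit_vu).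
rewrite !counit_series.
have [<-|ij] := eqVneq i j; last first.
  have [kj|_] := eqVneq k j; last by rewrite /= !(mul0r, mulr0, addr0, subr0).
  have [il|_] := eqVneq i l; last by rewrite /= !(mul0r, mulr0, addr0, subr0).
  by rewrite -kj -il /= !(mul0r, mulr0, addr0, subr0) subrr !(mulr0, subr0).
have [<-|kl] := eqVneq k l; last first.
  have [ki|_] := eqVneq k i; last by rewrite /= !(mul0r, mulr0, addr0, subr0).
  have [il|_] := eqVneq i l; last by rewrite /= !(mul0r, mulr0, addr0, subr0).
  by rewrite ki il eqxx in kl.
rewrite /sg addbb andFb expr0 mul1r /= subrr sub0r.
by have [->|ki] := eqVneq k i; rewrite ?ltnn /= !(mul0r, mulr0, addr0, subrr, oppr0).
Qed.

Lemma counit_ideal x : in_ideal relator x -> f x = 0.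
Proof.
elim=> [y /counit_relator //||y z _ hy _ hz|y z _ hz|y z _ hy].
- exact: f0.
- by rewrite fD hy hz addr0.
- by rewrite fM hz mulr0.
- by rewrite fM hy mul0r.
Qed.
End Counit.

End Relations.

Section QuantumAffine.
Variables (C : fieldType) (N : nat) (s : N.-tuple bool) (q : C).
Implicit Types (i j k l : 'I_N) (r : nat).

Local Notation gen := (bool * ('I_N * 'I_N) * nat)%type.
Local Notation free_alg := {malg C[{fmonom gen}]}.

Definition free_gen (g : bool) i j r : free_alg := << fmu (g, (i, j), r) >>.

Local Notation rel := (relator s q free_gen).

Definition Uq : Type := quot_alg rel.
HB.instance Definition _ := GRing.PzRing.on Uq.
HB.instance Definition _ := GRing.Lmodule.on Uq.

Definition t_gen i j r : Uq := to_quot rel (free_gen false i j r).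
Definition tbar_gen i j r : Uq := to_quot rel (free_gen true i j r).

Let counit_mon (m : {fmonom gen}) : C :=
  \prod_(x <- m) ((x.1.2.1 == x.1.2.2) && (x.2 == 0%N))%:R.

Let counit_mon_mmorphism : mmorphism counit_mon.
Proof.
split=> [m1 m2|]; rewrite /counit_mon; first by rewrite fmM big_cat.
by rewrite fm1 big_nil.
Qed.
HB.instance Definition _ :=
  isMultiplicative.Build {fmonom gen} C counit_mon counit_mon_mmorphism.

Fact Uq_oner_neq0 : 1 != 0 :> Uq.
Proof.
apply/eqP => /to_quotP; rewrite subr0 => /(@counit_ideal _ _ _ _ _ _ (mmap idfun counit_mon)) h.
suff /eqP : (1 : C) = 0 by rewrite oner_eq0.
rewrite -[LHS](rmorph1 (mmap idfun counit_mon)); apply: h.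
- by move=> c x; exact: mmapZ.
- exact: mmapB.
- exact: rmorphM.
- exact: rmorph1.
- by move=> g i j r; rewrite mmapU /= mul1r /counit_mon fmU big_seq1.
Qed.
HB.instance Definition _ := GRing.PzSemiRing_isNonZero.Build Uq Uq_oner_neq0.

Fact Uq_scaleAl (c : C) (x y : Uq) : c *: (x * y) = (c *: x) * y.
Proof. exact: quot_scaleAl. Qed.
HB.instance Definition _ := GRing.Lmodule_isLalgebra.Build C Uq Uq_scaleAl.

Lemma malg_scaleAr (K : monomType) (c : C) (x y : {malg C[K]}) :
  c *: (x * y) = x * (c *: y).
Proof.
have comm : x * c%:MP = c *: x.
  rewrite [LHS]malgM_def fgmulgU malgZ_def; apply/eq_bigr => k _.
  by rewrite mulm1 mulrC.
by rewrite -(mul_malgC c y) mulrA comm scalerAl.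
Qed.

Fact Uq_scaleAr (c : C) (x y : Uq) : c *: (x * y) = x * (c *: y).
Proof.
elim/quot_ind: x => x; elim/quot_ind: y => y.
rewrite -to_quotM -!to_quotZ -to_quotM; congr to_quot; exact: malg_scaleAr.
Qed.
HB.instance Definition _ := GRing.Lalgebra_isAlgebra.Build C Uq Uq_scaleAr.

Definition mon_parity (m : {fmonom gen}) : bool :=
  \big[addb/false]_(x <- m) (tnth s x.1.2.1 (+) tnth s x.1.2.2).

(* The component of parity p of the superalgebra Uq is the image of the span
   of the words of parity p in the generators. *)
Definition Uq_homog (p : bool) (x : Uq) : Prop :=
  exists2 f : free_alg, (forall m, f@_m != 0 -> mon_parity m = p)
                      & x = to_quot rel f.

(* Finite-dimensional representations are superspaces V = V_0 (+) V_1 with an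
   even algebra morphism Uq -> End(V). *)
Record superrep (V : vectType C) := SuperRep {
  rep_part : bool -> {vspace V};
  rep_act : {linear Uq -> 'End(V)};
  rep_part_full : (rep_part false + rep_part true = fullv)%VS;
  rep_part_direct : (rep_part false :&: rep_part true = 0)%VS;
  rep_act1 : rep_act 1 = \1%VF;
  rep_actM x y : rep_act (x * y) = (rep_act x \o rep_act y)%VF;
  rep_parity p p' x :
    Uq_homog p x -> (rep_act x @: rep_part p' <= rep_part (p (+) p'))%VS
}.

Section Representations.
Variables (V : vectType C) (rho : superrep V).

Definition subrep (W : {vspace V}) : Prop :=
  (W = W :&: rep_part rho false + W :&: rep_part rho true)%VS /\
  forall x, (rep_act rho x @: W <= W)%VS.

Definition irreducible_rep : Prop :=
  fullv <> 0%VS :> {vspace V} /\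
  forall W, subrep W -> W = 0%VS \/ W = fullv.

Definition highest_weight_rep : Prop :=
  exists (zeta : V) (lam lambar : 'I_N -> nat -> C),
  [/\ zeta <> 0,
      forall v, exists x, v = rep_act rho x zeta,
      forall i j r, (i < j)%N ->
        rep_act rho (t_gen i j r) zeta = 0 /\
        rep_act rho (tbar_gen i j r) zeta = 0,
      forall i r,
        rep_act rho (t_gen i i r) zeta = lam i r *: zeta /\
        rep_act rho (tbar_gen i i r) zeta = lambar i r *: zeta
    & forall i, lam i 0%N * lambar i 0%N = 1].

End Representations.

End QuantumAffine.

(* The parity sequences with m zeros and n ones; true encodes the digit 1. *)
Definition parity_seqs (m n : nat) : {pred (m + n).-tuple bool} :=
  [pred s : (m + n).-tuple bool | (count_mem false s == m) && (count_mem true s == n)].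
Arguments parity_seqs : clear implicits.

(* Main.v *)
Require Import Defs.
From HB Require Import structures.
From mathcomp Require Import all_boot all_order all_algebra.
From mathcomp Require Import zify.
From mathcomp Require Import boolp reals complex finmap monalg.

Set Implicit Arguments.
Unset Strict Implicit.
Unset Printing Implicit Defensive.

Import Order.TTheory GRing.Theory Num.Theory.
Local Open Scope ring_scope.

(* The zero modes t_ii^(0), inverted when i is odd, combine into an even
   invertible element D such that D x_kl^(r) = q^(l - k) x_kl^(r) D for x = t
   and x = tbar. Since q is not a root of unity and V is finite-dimensional, D
   has an eigenvalue mu such that no mu q^k with k > 0 is an eigenvalue. Hence
   all x_kl^(r) with k < l kill the mu-eigenspace of D, which is graded and
   stable under all x_ii^(r). The latter commute on it, so they have a common
   homogeneous eigenvector, which generates V by irreducibility. *)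

(** * Linear algebra: subspaces, common eigenvectors, extremal eigenvalues *)

(** A subspace of largest dimension inside [S] exhausts [S], since adjoining one more vector of [S]
    would enlarge it. This turns the orbit of a vector into a [{vspace V}]. *)
Lemma lin_pred_vspace (K : fieldType) (V : vectType K) (S : V -> Prop) :
    S 0 -> (forall a u v, S u -> S v -> S (a *: u + v)) ->
  exists W : {vspace V}, forall v, v \in W <-> S v.
Proof.
move=> S0 SD.
pose P k := `[< exists U : {vspace V},
  \dim U = k /\ forall v, v \in U -> S v >].
have P0 : exists k, P k.
  exists 0%N; apply/asboolP; exists 0%VS; rewrite dimv0; split=> // v.
  by rewrite memv0 => /eqP->.
have Pmax k : P k -> (k <= \dim {:V})%N.
  by move=> /asboolP[U [<- _]]; rewrite dimvS ?subvf.
case: (ex_maxnP P0 Pmax) => k /asboolP[U [dU US]] kmax.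
exists U => v; split=> [/US //|Sv]; apply: contrapT => /negP vU.
have : P (\dim (U + <[v]>)).
  apply/asboolP; exists (U + <[v]>)%VS; split=> // w.
  case/memv_addP=> u uU [_ /vlineP[a ->] ->]; rewrite addrC.
  by apply: SD => //; apply: US.
move=> /kmax; rewrite -dU leqNgt => /negP[].
rewrite ltnNge; apply/negP => le.
have /eqP e : U == (U + <[v]>)%VS by rewrite eqEdim addvSl.
by move: vU; rewrite e (subvP (addvSr _ _)) // memv_line.
Qed.

Lemma stable_eigenvector (C : numClosedFieldType) (V : vectType C)
    (f : 'End(V)) (W : {vspace V}) :
    W != 0%VS -> (forall v, v \in W -> f v \in W) ->
  exists mu v, [/\ v \in W, v != 0 & f v = mu *: v].
Proof.
move=> W0 fW; pose b := vbasis W.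
have bW : basis_of W b := vbasisP W.
(* Row i holds the coordinates of the image of the i-th basis vector, so a row eigenvector of [A]
   lists the coefficients of an eigenvector of [f]. *)
pose A : 'M[C]_(\dim W) := \matrix_(i, j) coord b j (f b`_i).
have [|mu /eigenvalueP[u uA u0]] := eigenvalue_closed A.
  by rewrite lt0n dimv_eq0.
have bE i : b`_(i : 'I_(\dim W)) \in W.
  by rewrite vbasis_mem ?mem_nth ?size_tuple.
pose v := \sum_i u 0 i *: b`_i; exists mu, v.
have cb w : w \in W -> w = \sum_i coord b i w *: b`_i.
  exact: coord_basis.
have cv i : coord b i v = u 0 i by rewrite coord_sum_free ?(basis_free bW).
have vW : v \in W by apply: memv_suml => i _; apply: memvZ.
split=> //.
  apply: contra_neq u0 => v0; apply/rowP => i.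
  by rewrite mxE -cv v0 linear0.
rewrite linear_sum; have -> : \sum_i f (u 0 i *: b`_i) =
    \sum_j (\sum_i u 0 i * A i j) *: b`_j.
  under [RHS]eq_bigr do rewrite scaler_suml.
  rewrite exchange_big /=; apply: eq_bigr => i _.
  rewrite linearZ /= {1}[f _]cb ?fW // scaler_sumr; apply: eq_bigr => j _.
  by rewrite scalerA mxE.
rewrite scaler_sumr; apply: eq_bigr => j _.
by rewrite scalerA; congr (_ *: _); move/rowP/(_ j): uA; rewrite !mxE.
Qed.

(** On a nonzero stable subspace [U] of least dimension every [f i] is a scalar: its eigenspace in
    [U] is again stable because the maps commute, hence equals [U]. The family may be infinite. *)
Lemma commuting_eigenvector (C : numClosedFieldType) (V : vectType C)
    (I : Type) (f : I -> 'End(V)) (W : {vspace V}) :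
    W != 0%VS -> (forall i v, v \in W -> f i v \in W) ->
    (forall i j v, v \in W -> f i (f j v) = f j (f i v)) ->
  exists2 v, v \in W & v != 0 /\ forall i, exists c, f i v = c *: v.
Proof.
move=> W0 fW fC.
pose P k := `[< exists U : {vspace V}, [/\ \dim U = k, U != 0%VS, (U <= W)%VS
   & forall i v, v \in U -> f i v \in U] >].
have exP : exists k, P k by exists (\dim W); apply/asboolP; exists W.
case: (ex_minnP exP) => k /asboolP[U [dU U0 UW fU]] kmin.
exists (vpick U); first exact: subvP UW _ (memv_pick U).
rewrite vpick0; split=> // i.
have [mu [v [vU v0 fv]]] := stable_eigenvector U0 (fU i).
pose U' := (U :&: lker (f i - mu *: \1%VF))%VS.
have kE w : (w \in lker (f i - mu *: \1%VF)%VF) = (f i w == mu *: w).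
  by rewrite memv_ker add_lfunE opp_lfunE scale_lfunE id_lfunE subr_eq0.
have sU : (U' <= U)%VS by apply: capvSl.
have /kmin : P (\dim U').
  apply/asboolP; exists U'; split=> //.
  - apply: contra_neq v0 => e; apply/eqP.
    by rewrite -memv0 -e memv_cap vU kE fv /=.
  - exact: subv_trans UW.
  - move=> j w; rewrite !memv_cap !kE => /andP[wU /eqP fw].
    by rewrite fU //= fC ?fw ?linearZ // (subvP UW).
rewrite -dU => le; have /eqP e : U' == U by rewrite eqEdim sU.
have : vpick U \in U' by rewrite e memv_pick.
by rewrite memv_cap kE => /andP[_ /eqP ->]; exists mu.
Qed.

Lemma eigenvalues_finite (K : fieldType) (V : vectType K) (f : 'End(V))
    (mu : nat -> K) : injective mu ->
  ~ (forall k, exists2 v, v != 0 & f v = mu k *: v).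
Proof.
move=> mu_inj ev.
pose b := vbasis {:V}; have bV : basis_of {:V} b := vbasisP _.
pose A := passmx.mxof b b f.
(* The size of a polynomial is its degree plus one, hence one root too many. *)
pose rs := [seq mu k | k <- iota 0 (size (char_poly A))].
have : (size rs < size (char_poly A))%N.
  apply: max_poly_roots.
  - by rewrite monic_neq0 ?char_poly_monic.
  - apply/allP => _ /mapP[k _ ->]; rewrite -eigenvalue_root_char.
    have [v v0 fv] := ev k; apply/eigenvalueP; exists (passmx.rVof b v).
      by rewrite -passmx.rVof_app // fv; apply/rowP => i; rewrite !mxE linearZ.
    by rewrite passmx.rVof_eq0.
  - by rewrite map_inj_uniq ?iota_uniq.
by rewrite size_map size_iota ltnn.
Qed.

(** Otherwise, starting from any eigenvalue [mu], there would be eigenvalues [mu * q ^+ j] with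
    arbitrarily large [j]. They are pairwise distinct, as [mu] is nonzero and [q] is not a root of
    unity, so there would be infinitely many. *)
Lemma maximal_eigenvalue (C : numClosedFieldType) (V : vectType C)
    (f : 'End(V)) (q : C) :
    q != 0 -> (forall k, (0 < k)%N -> ~~ k.-unity_root q) ->
    fullv != 0%VS :> {vspace V} -> (forall v, f v = 0 -> v = 0) ->
  exists2 mu, exists2 v, v != 0 & f v = mu *: v &
    forall k v, (0 < k)%N -> f v = mu * q ^+ k *: v -> v = 0.
Proof.
move=> q0 q1 V0 finj.
have [//|mu [v [_ v0 fv]]] := stable_eigenvector (f := f) V0.
  by move=> *; rewrite memvf.
have mu0 : mu != 0.
  by apply: contraNneq v0 => mu0; apply/eqP/finj; rewrite fv mu0 scale0r.
apply: contrapT => nex.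
have ev k : exists2 j, (k <= j)%N & exists2 w, w != 0 & f w = mu * q ^+ j *: w.
  elim: k => [|k [j kj evj]].
    by exists 0%N => //; exists v; rewrite // mulr1.
  apply: contrapT => nj; apply: nex; exists (mu * q ^+ j) => // i w i0 fw.
  apply/eqP/negPn/negP => w0; apply: nj; exists (j + i)%N.
    by rewrite -addn1 leq_add.
  by exists w; rewrite // exprD mulrA.
have q_inj i j : (i < j)%N -> q ^+ i != q ^+ j.
  move=> ij; apply/eqP => e.
  have := q1 (j - i)%N; rewrite subn_gt0 ij => /(_ isT).
  rewrite unity_rootE => /negP[]; apply/eqP.
  apply: (mulfI (expf_neq0 i q0)); rewrite -exprD subnKC ?mulr1 //.
  exact: ltnW.
have /choice[g gP] k : exists j, (k <= j)%N /\
    exists2 w, w != 0 & f w = mu * q ^+ j *: w.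
  by have [j kj evj] := ev k; exists j.
(* A strictly increasing sequence of exponents whose eigenvalues all occur. *)
pose h := fix h k := if k is k'.+1 then g (h k').+1 else g 0%N.
have hlt : {homo h : i j / (i < j)%N}.
  apply: homo_ltn => [j i k|i]; first exact: ltn_trans.
  by have [] := gP (h i).+1.
apply: (@eigenvalues_finite _ _ f (fun k => mu * q ^+ (h k))).
  move=> i j /(mulfI mu0) e.
  case: (ltngtP i j) => // /hlt /q_inj; by rewrite e eqxx.
by case=> [|k]; [have [] := gP 0%N|have [] := gP (h k).+1].
Qed.

(** * Formal series in u and v annihilated by polynomial factors *)

Lemma subrACA (W : zmodType) (x y z t : W) :
  (x - y) - (z - t) = (x - z) - (y - t).
Proof. by rewrite opprD addrACA -opprD. Qed.

(** Descending induction on the exponent of u, from the range where the support condition gives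
    zero. *)
Lemma vanish_below (V : zmodType) (G : int -> int -> V) :
    (forall a b, 0 < a -> G a b = 0) ->
    (forall a, (forall b, G a b = 0) -> forall b, G (a - 1) b = 0) ->
  forall a b, G a b = 0.
Proof.
move=> G0 GS a b; have [/G0 //|a0] := ltP 0 a.
have Gn n : forall b', G (1 - n%:Z) b' = 0.
  elim: n => [|n IH]; first by rewrite subr0 => b'; apply: G0.
  by rewrite -addn1 PoszD opprD addrA; apply: GS.
have -> : a = 1 - (`|1 - a|%N)%:Z by rewrite gez0_abs; lia.
exact: Gn.
Qed.

(* G encodes a formal series in u, v with (x u + y v) G = 0; the support
   condition excludes formal delta functions. *)
Lemma linear_factor_inj (K : fieldType) (V : lmodType K) (x y : K)
    (G : int -> int -> V) :
    x != 0 -> y != 0 -> (forall a b, x *: G (a - 1) b + y *: G a (b - 1) = 0) ->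
    (forall a b, 0 < a -> G a b = 0) \/ (forall a b, a < 0 -> G a b = 0) ->
  forall a b, G a b = 0.
Proof.
move=> x0 y0 rel [G0|G0].
  apply: vanish_below => // a Ga b; apply: (scalerI x0).
  by have := rel a b; rewrite Ga !scaler0 addr0.
(* Support bounded below in u becomes support bounded above after replacing u by its inverse. *)
suff H a b : G (- a) b = 0 by move=> a b; rewrite -[a]opprK H.
apply: (@vanish_below _ (fun a b => G (- a) b)) => {}a.
  by move=> {}b a0; apply: G0; rewrite oppr_lt0.
move=> Ga b'; apply: (scalerI y0).
have := rel (- a + 1) (b' + 1); rewrite !addrK Ga scaler0 add0r scaler0.
by rewrite opprB addrC.
Qed.

(* For formal series these are (v - u) G = k H and (v - u) H = k' uv G; hence
   ((v - u)^2 - k k' uv) G = 0, a polynomial whose u^2 coefficient is 1. *)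
Lemma coupled_factor_inj (K : fieldType) (V : lmodType K) (k k' : K)
    (G H : int -> int -> V) :
    (forall a b, G a (b - 1) - G (a - 1) b = k *: H a b) ->
    (forall a b, H a (b - 1) - H (a - 1) b = k' *: G (a - 1) (b - 1)) ->
    (forall a b, 0 < a -> G a b = 0) -> (forall a b, 1 < a -> H a b = 0) ->
  forall a b, G a b = 0.
Proof.
move=> GH HG G0 H0 a b.
(* [H] is taken one degree higher in u: its relation at [a + 1] involves [G] only at [a] and yields
   [H a], after which the relation for [G] at [a] yields [G (a - 1)]. *)
suff /(_ a b) [-> //] : forall a b, (G a b, H (a + 1) b) = (0, 0).
apply: (@vanish_below (V * V)%type (fun a b => (G a b, H (a + 1) b))).
  by move=> {}a {}b a0; rewrite G0 ?H0 // -[X in X < _]add0r ltrD2r.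
move=> {}a ab {}b.
have Ga b' : G a b' = 0 by have [] := ab b'.
have Ha b' : H a b' = 0.
  have [_ H1] := ab (b' - 1).
  have := HG (a + 1) b'; rewrite addrK Ga scaler0.
  by rewrite H1 sub0r => /eqP; rewrite oppr_eq0 => /eqP.
have := GH a b; rewrite Ga Ha scaler0 sub0r => /eqP.
by rewrite oppr_eq0 subrK Ha => /eqP ->.
Qed.

(** * Action of the coefficients, and the weight element D *)

Section Representation.
Variables (C : numClosedFieldType) (N : nat) (s : N.-tuple bool) (q : C).
Variables (A : lalgType C) (X : bool -> 'I_N -> 'I_N -> nat -> A).
Variables (V : vectType C) (act : A -> 'End(V)).
Hypothesis q0 : q != 0.
Hypothesis actD : forall x y v, act (x + y) v = act x v + act y v.
Hypothesis actZ : forall c x v, act (c *: x) v = c *: act x v.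
Hypothesis act1 : forall v, act 1 v = v.
Hypothesis actM : forall x y v, act (x * y) v = act x (act y v).
Hypothesis act_relator : forall x v, relator s q X x -> act x v = 0.
Implicit Types (i j k l : 'I_N) (a b : int) (g : bool) (v w : V).

Local Notation par i := (tnth s i).
Local Notation Q := (qi s q).
Local Notation Sg := (Defs.sg C s).

Lemma actB x y v : act (x - y) v = act x v - act y v.
Proof. by rewrite actD -scaleN1r actZ scaleN1r. Qed.

Lemma act0 v : act 0 v = 0.
Proof. by rewrite -[0](subrr 0) actB subrr. Qed.

(* The coefficient of u^a in t_ij(u) (g = false) or tbar_ij(u) (g = true). *)
Definition coef g i j a : 'End(V) := act (gen_series X g i j a).

Lemma coef_false_nat i j (r : nat) :
  coef false i j (- r%:Z) = act (X false i j r).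
Proof. by rewrite /coef /gen_series oppr_le0 abszN. Qed.

Lemma coef_true_nat i j (r : nat) : coef true i j r = act (X true i j r).
Proof. by []. Qed.

Lemma coef_false_gt0 i j a v : 0 < a -> coef false i j a v = 0.
Proof. by rewrite /coef /gen_series leNgt => ->; apply: act0. Qed.

Lemma coef_true_lt0 i j a v : a < 0 -> coef true i j a v = 0.
Proof. by rewrite /coef /gen_series leNgt => ->; apply: act0. Qed.

Lemma coef_false_00 i j v : (i < j)%N -> coef false i j 0 v = 0.
Proof.
by move=> ij; rewrite -oppr0 coef_false_nat act_relator //; constructor.
Qed.

Lemma coef_00K i v : coef false i i 0 (coef true i i 0 v) = v.
Proof.
rewrite -{1}oppr0 coef_false_nat coef_true_nat -actM.
apply/eqP; rewrite -subr_eq0 -[v in X in _ - X]act1 -actB act_relator //.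
by constructor.
Qed.

Lemma coef_00VK i v : coef true i i 0 (coef false i i 0 v) = v.
Proof.
rewrite -{2}oppr0 coef_false_nat coef_true_nat -actM.
apply/eqP; rewrite -subr_eq0 -[v in X in _ - X]act1 -actB act_relator //.
by constructor.
Qed.

Lemma act_lin_uv x y (S T : series A) a b v :
  act (lin_mul x y (prod_uv S T) a b) v =
  x *: act (S (a - 1)) (act (T b) v) + y *: act (S a) (act (T (b - 1)) v).
Proof. by rewrite /lin_mul actD !actZ !actM. Qed.

Lemma act_lin_vu x y (S T : series A) a b v :
  act (lin_mul x y (prod_vu T S) a b) v =
  x *: act (T b) (act (S (a - 1)) v) + y *: act (T (b - 1)) (act (S a) v).
Proof. by rewrite /lin_mul actD !actZ !actM. Qed.

Lemma rtt_coef g g' i j k l a b v :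
    (g, g') \in [:: (false, false); (true, true); (false, true)] ->
  (- Q i ^+ (i == k)) *: coef g i j (a - 1) (coef g' k l b v)
    + Q i ^- (i == k) *: coef g i j a (coef g' k l (b - 1) v)
  - Sg i j k l *:
    ((- Q j ^+ (j == l)) *: coef g' k l b (coef g i j (a - 1) v)
      + Q j ^- (j == l) *: coef g' k l (b - 1) (coef g i j a v))
  = (Sg i k k l * (Q k - (Q k)^-1)) *:
    ((k < i)%N%:R *: coef g k j (a - 1) (coef g' i l b v)
       + (i < k)%N%:R *: coef g k j a (coef g' i l (b - 1) v)
     - ((j < l)%N%:R *: coef g' k j b (coef g i l (a - 1) v)
       + (l < j)%N%:R *: coef g' k j (b - 1) (coef g i l a v))).
Proof.
move=> gg'; have := act_relator v (rel_rtt s q X i j k l a b gg').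
rewrite actB => /eqP; rewrite subr_eq0 => /eqP.
by rewrite /rtt_lhs /rtt_rhs actB !actZ actB !act_lin_uv !act_lin_vu.
Qed.

Lemma qi_neq0 i : Q i != 0.
Proof. by rewrite /qi expfz_neq0. Qed.

Lemma sg_diagl i k l : Sg i i k l = 1.
Proof. by rewrite /Defs.sg addbb. Qed.

Lemma sg_diagr i j k : Sg i j k k = 1.
Proof. by rewrite /Defs.sg addbb andbF. Qed.

(** In the coefficient of u^1 of the relation, t_ii(u) contributes only its constant term. The
    right-hand side leaves t_ki^(0) with k < i and t_il^(0) with i < l, which vanish by
    triangularity. *)
Lemma coef_t0_comm g i k l b v :
  coef false i i 0 (coef g k l b v) =
    (Q i ^+ (i == l) / Q i ^+ (i == k)) *: coef g k l b (coef false i i 0 v).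
Proof.
have := @rtt_coef false g i i k l 1 b v.
rewrite subrr sg_diagl scale1r !(@coef_false_gt0 _ _ 1) //.
have -> : (k < i)%N%:R *: coef false k i 0 (coef g i l b v) = 0.
  by case: ltnP => [ki|]; rewrite ?scale0r // coef_false_00 ?scaler0.
have -> : (i < l)%N%:R *: coef g k i b (coef false i l 0 v) = 0.
  by case: ltnP => [il|]; rewrite ?scale0r // coef_false_00 ?linear0 ?scaler0.
rewrite !linear0 !addr0 subrr linear0 !scaleNr opprK addrC.
case: g => /(_ isT) /eqP; rewrite subr_eq0 => /eqP e;
  by rewrite mulrC -scalerA e scalerA mulVf ?scale1r // expf_neq0 // qi_neq0.
Qed.

(* For odd i one has q_i = q^-1, so that inverting t_ii^(0) makes the two
   parities uniform in Kop_comm. *)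
Definition Kop i := coef (par i) i i 0.

Lemma Kop_inj i v : Kop i v = 0 -> v = 0.
Proof.
rewrite /Kop; case: (par i) => e.
  by rewrite -(coef_00K i v) e linear0.
by rewrite -(coef_00VK i v) e linear0.
Qed.

Lemma Kop_comm g i k l b v :
  Kop i (coef g k l b v) =
    (q ^+ (i == l) / q ^+ (i == k)) *: coef g k l b (Kop i v).
Proof.
rewrite /Kop; case p: (par i); last first.
  by rewrite coef_t0_comm /qi p expr1z.
have := coef_t0_comm g i k l b (coef true i i 0 v).
rewrite coef_00K => /(congr1 (coef true i i 0)).
rewrite coef_00VK linearZ /= => ->.
rewrite /qi p exprN1 !exprVn scalerA mulrACA.
by rewrite !divff ?invr_eq0 ?expf_neq0 // mulr1 scale1r.
Qed.

(** By [Kop_comm], moving the i-th zero mode past x_kl costs q to the power (i = l) - (i = k). The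
    exponent [i] makes these costs add up to l - k. *)
Definition weight_elt : A := \prod_i X (par i) i i 0 ^+ i.
Local Notation D := (act weight_elt).

Lemma coef_0E g i j v : coef g i j 0 v = act (X g i j 0) v.
Proof. by case: g => //; rewrite -[0 in LHS]oppr0 coef_false_nat. Qed.

Lemma weight_elt_inj v : D v = 0 -> v = 0.
Proof.
have inj1 i w : act (X (par i) i i 0) w = 0 -> w = 0.
  by rewrite -coef_0E; apply: Kop_inj.
rewrite /weight_elt; elim/big_ind: _ v => [v|x y xi yi v|i _].
- by rewrite act1.
- by rewrite actM => /xi /yi.
elim: (nat_of_ord i) => [v|k IH v]; first by rewrite expr0 act1.
by rewrite exprS actM => /inj1 /IH.
Qed.

(** Applied to the graded components, this says that [D] is even. *)
Lemma weight_elt_stable (U : {vspace V}) :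
    (forall i v, v \in U -> act (X (par i) i i 0) v \in U) ->
  forall v, v \in U -> D v \in U.
Proof.
move=> XU; rewrite /weight_elt; elim/big_ind: _ => [v|x y xi yi v|i _].
- by rewrite act1.
- by rewrite actM => /yi /xi.
elim: (nat_of_ord i) => [v|k IH v]; first by rewrite expr0 act1.
by rewrite exprS actM => /IH /XU.
Qed.

Lemma weight_elt_comm g k l b v : (k <= l)%N ->
  D (coef g k l b v) = q ^+ (l - k) *: coef g k l b (D v).
Proof.
move=> kl; pose c i : C := (q ^+ (i == l) / q ^+ (i == k)) ^+ i.
(* Only the factors at [l] and [k] differ from 1; [k <= l] makes the natural subtraction exact. *)
have -> : q ^+ (l - k) = \prod_i c i.
  rewrite /c (eq_bigr (fun i : 'I_N =>
    (q ^+ (i == l)) ^+ i / (q ^+ (i == k)) ^+ i)).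
    rewrite prodf_div (bigD1 l) //= [in X in _ / X](bigD1 k) //= !eqxx !expr1.
    rewrite !big1 ?mulr1 => [|i /negPf->|i /negPf->]; rewrite ?expr1n //.
    by rewrite expfB_cond ?(negPf q0).
  by move=> i _; rewrite expr_div_n.
rewrite /weight_elt.
elim/big_rec2: _ v => [v|i y x _ IH v]; first by rewrite !act1 scale1r.
rewrite !actM IH linearZ /=.
rewrite [X in _ *: X](_ : _ =
  c i *: coef g k l b (act (X (par i) i i 0 ^+ i) (act x v))).
  by rewrite scalerA mulrC.
move: (act x v) => {}v; rewrite /c; elim: (nat_of_ord i) v => [|n IHn] v.
  by rewrite !expr0 !act1 scale1r.
rewrite !exprS !actM IHn linearZ /= -!coef_0E -/(Kop i) Kop_comm.
by rewrite scalerA mulrC.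
Qed.

Lemma coef_support g i j :
  (forall a v, 0 < a -> coef g i j a v = 0) \/
  (forall a v, a < 0 -> coef g i j a v = 0).
Proof.
by case: g; [right|left] => a v; [apply: coef_true_lt0|apply: coef_false_gt0].
Qed.

Lemma coef_v0 g i j a : coef g i j a 0 = 0.
Proof. exact: linear0. Qed.

Lemma sg_neq0 i j k l : Sg i j k l != 0.
Proof. by rewrite /Defs.sg signr_eq0. Qed.

(** Here q_i - 1/q_i = d_i (q - 1/q), and the sign is d_i d_k. *)
Lemma sg_qi_swap i k : Sg k i i k * (Q i - (Q i)^-1) = Q k - (Q k)^-1.
Proof.
rewrite /Defs.sg /qi; case: (par i); case: (par k);
  by rewrite /= ?exprN1 ?expr1z ?expr0 ?expr1 ?mul1r ?invrK ?mulN1r ?opprB.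
Qed.

(** * Diagonal coefficients commute on a vector killed by the raising ones *)

Section HighestVector.
Variable v : V.
Hypothesis raise0 : forall g i j a, (i < j)%N -> coef g i j a v = 0.

Let comm g g' i k a b :=
  coef g i i a (coef g' k k b v) - coef g' k k b (coef g i i a v).

Let comm_support g g' i k :
  (forall a b, 0 < a -> comm g g' i k a b = 0) \/
  (forall a b, a < 0 -> comm g g' i k a b = 0).
Proof.
by case: (coef_support g i i) => c0; [left|right] => a b ha;
  rewrite /comm !c0 // linear0 subr0.
Qed.

Let rel_pairs : seq (bool * bool) :=
  [:: (false, false); (true, true); (false, true)].

(** With all indices equal the right-hand side is zero and both products carry the factor v/q_i -
    q_i u, which therefore annihilates the commutator. *)
Let comm_diag g g' i a b : (g, g') \in rel_pairs -> comm g g' i i a b = 0.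
Proof.
move=> gg'; move: a b; apply: (@linear_factor_inj _ _ (- Q i) (Q i)^-1).
- by rewrite oppr_eq0 qi_neq0.
- by rewrite invr_eq0 qi_neq0.
- move=> a b; have := rtt_coef i i i i a b v gg'.
  rewrite !eqxx !expr1 sg_diagl ltnn !scale0r !addr0 subrr scaler0 scale1r => e.
  by rewrite /comm !scalerBr addrACA -opprD.
exact: comm_support.
Qed.

(** Both products on the right-hand side first apply a coefficient with indices i < k, which kills
    [v]. What remains is v - u times the commutator. *)
Let comm_lt g g' i k a b :
  (g, g') \in rel_pairs -> (i < k)%N -> comm g g' i k a b = 0.
Proof.
move=> gg' ik; move: a b; apply: (@linear_factor_inj _ _ (- 1) 1).
- by rewrite oppr_eq0 oner_eq0.
- exact: oner_neq0.
- move=> a b; have := rtt_coef i i k k a b v gg'.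
  have -> : (i == k) = false by apply/eqP => e; rewrite e ltnn in ik.
  have ki : (k < i)%N = false by rewrite ltnNge (ltnW ik).
  rewrite expr0 invr1 sg_diagl ki ik !(raise0 _ _ ik) !coef_v0 !scale1r.
  rewrite !scale0r !addr0 subrr scaler0 => e.
  by rewrite /comm !scalerBr addrACA -opprD.
exact: comm_support.
Qed.

(* The right-hand side of the relation for t_ii, tbar_kk involves
   H = u t_ki(u) tbar_ik(v) - v tbar_ki(v) t_ik(u). The relations for its two
   terms express H through the commutator again, because the contributions
   t_kk(u) tbar_ii(v) cancel by comm_lt and sg_qi_swap. *)
Let comm_gt i k a b : (k < i)%N -> comm false true i k a b = 0.
Proof.
move=> ki; have gg' : (false, true) \in rel_pairs by [].
have ik_neq : (i == k) = false by apply/eqP => e; rewrite e ltnn in ki.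
have ki_neq : (k == i) = false by rewrite eq_sym.
have ik : (i < k)%N = false by rewrite ltnNge (ltnW ki).
pose kappa := Q k - (Q k)^-1.
pose Ar a b := coef false k i a (coef true i k b v).
pose Br a b := coef true k i b (coef false i k a v).
pose Pr a b := coef false i i a (coef true k k b v).
pose Qr a b := coef true k k b (coef false i i a v).
pose Sr a b := coef false k k a (coef true i i b v).
have ArE a' b' : Ar a' (b' - 1) - Ar (a' - 1) b' =
    kappa *: (Pr a' (b' - 1) - Sr a' (b' - 1)).
  have := rtt_coef k i i k a' b' v gg'.
  rewrite ki_neq ik_neq ki ik expr0 invr1 !(raise0 _ _ ki) !coef_v0 !scale1r.
  rewrite !scale0r !add0r !scaler0 addr0 scaler0 subr0 sg_qi_swap.
  rewrite scaleN1r addrC.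
  (* The relation gives tbar_ii(v) t_kk(u); reordering turns it into [Sr], the term that also
     appears in [BrE]. *)
  by have /subr0_eq <- := comm_lt a' (b' - 1) gg' ki.
have BrE a' b' : Br a' (b' - 1) - Br (a' - 1) b' =
    - kappa *: (Sr (a' - 1) b' - Qr (a' - 1) b').
  have := rtt_coef i k k i a' b' v gg'.
  rewrite ki_neq ik_neq ki ik expr0 invr1 !(raise0 _ _ ki) !coef_v0 !scale1r.
  rewrite !scale0r !addr0 !scaler0 add0r scaleN1r.
  rewrite -scalerA -scalerN => /(scalerI (sg_neq0 _ _ _ _)).
  by rewrite scaleNr => <-; rewrite opprK addrC.
pose H a b := Ar (a - 1) b - Br a (b - 1).
move: a b; apply: (@coupled_factor_inj _ _ kappa kappa _ H) => a b.
- have := rtt_coef i i k k a b v gg'.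
  rewrite ik_neq expr0 invr1 sg_diagl sg_diagr ik ki !scale1r !scale0r.
  rewrite mul1r addr0 add0r !scaleN1r => <-.
  by rewrite /comm subrACA ![- _ + _]addrC.
- by rewrite /H subrACA ArE BrE scaleNr opprK -scalerDr subrKA.
- by move=> a0; rewrite /comm !(coef_false_gt0 _ _ _ a0) linear0 subr0.
- move=> a1; have a10 : 0 < a - 1 by rewrite subr_gt0.
  have a0 : 0 < a by apply: lt_trans a1.
  by rewrite /H /Ar /Br !coef_false_gt0 // linear0 subr0.
Qed.

Lemma coef_diag_comm g g' i k a b :
  coef g i i a (coef g' k k b v) = coef g' k k b (coef g i i a v).
Proof.
(* The pair (tbar, t) is the pair (t, tbar) read backwards with the indices exchanged. *)
suff H h h' j l c d : (h, h') \in rel_pairs -> comm h h' j l c d = 0.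
  case: g g' => [] []; try by apply/eqP; rewrite -subr_eq0; apply/eqP/H.
  by apply/esym/eqP; rewrite -subr_eq0; apply/eqP/H.
move=> hh'; case: (ltngtP j l) => [jl|lj|/val_inj <-].
- exact: comm_lt.
(* For two series of the same kind the commutator is antisymmetric, which reduces to [comm_lt]; only
   the mixed pair requires [comm_gt]. *)
- move: hh' lj; rewrite !inE; case/or3P => /eqP[-> ->] lj.
  + by rewrite -oppr0 -(comm_lt d c (g := false) (g' := false) _ lj) // opprB.
  + by rewrite -oppr0 -(comm_lt d c (g := true) (g' := true) _ lj) // opprB.
  + exact: comm_gt.
- exact: comm_diag.
Qed.

End HighestVector.

(** * Existence of a homogeneous highest weight vector *)

Lemma highest_vector (P : bool -> {vspace V}) :
    (forall k : nat, (0 < k)%N -> ~~ k.-unity_root q) ->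
    fullv != 0%VS :> {vspace V} ->
    (P false + P true = fullv)%VS -> (P false :&: P true = 0)%VS ->
    (forall g i r p v, v \in P p -> act (X g i i r) v \in P p) ->
  exists p zeta, [/\ zeta \in P p, zeta != 0,
    forall g i j r, (i < j)%N -> act (X g i j r) zeta = 0 &
    forall g i r, exists c, act (X g i i r) zeta = c *: zeta].
Proof.
move=> q1 V0 Pfull Pdirect PX.
have [mu [v v0 Dv] mumax] := maximal_eigenvalue q0 q1 V0 weight_elt_inj.
pose E := lker (D - mu *: \1%VF).
have EE w : (w \in E) = (D w == mu *: w).
  by rewrite memv_ker add_lfunE opp_lfunE scale_lfunE id_lfunE subr_eq0.
have PD p w : w \in P p -> D w \in P p.
  by apply: weight_elt_stable => i; apply: PX.
have [p Ep0] : exists p, (E :&: P p)%VS != 0%VS.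
  have /memv_addP[v1 v1P [v2 v2P vE]] : v \in (P false + P true)%VS.
    by rewrite Pfull memvf.
  (* As [D] is even, the two sides lie in different graded components, so both vanish and each
     component of [v] satisfies the eigenvalue equation. *)
  have D12 : D v1 - mu *: v1 = - (D v2 - mu *: v2).
    apply/eqP; rewrite -addr_eq0 addrACA -opprD -scalerDr -linearD /= -vE Dv.
    by rewrite subrr.
  have D1 : D v1 - mu *: v1 = 0.
    apply/eqP; rewrite -memv0 -Pdirect memv_cap {2}D12 rpredN.
    by rewrite !rpredB ?rpredZ ?PD.
  have v1E : v1 \in E by rewrite EE -subr_eq0 D1.
  have v2E : v2 \in E by rewrite EE -subr_eq0 -oppr_eq0 -D12 D1.
  have [v10|v10] := eqVneq v1 0.
    exists true; apply: contra_neq v0 => e; apply/eqP.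
    by rewrite vE v10 add0r -memv0 -e memv_cap v2E.
  exists false; apply: contra_neq v10 => e; apply/eqP.
  by rewrite -memv0 -e memv_cap v1E.
have raise0 w : w \in E -> forall g i j a, (i < j)%N -> coef g i j a w = 0.
  rewrite EE => /eqP Dw g i j a ij.
  apply: (mumax (j - i)%N); first by rewrite subn_gt0.
  by rewrite weight_elt_comm ?(ltnW ij) // Dw linearZ /= scalerA mulrC.
have coefX g i j r : exists a, act (X g i j r) = coef g i j a.
  by case: g; [exists r%:Z|exists (- r%:Z); rewrite coef_false_nat].
have [[[g i] r] w|[[g i] r] [[g' j] r'] w|z] := @commuting_eigenvector _ _ _
    (fun x : bool * 'I_N * nat => act (X x.1.1 x.1.2 x.1.2 x.2))
    (E :&: P p)%VS Ep0.
- rewrite !memv_cap /= => /andP[wE wP]; rewrite PX // andbT.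
  have [a ->] := coefX g i i r; rewrite EE weight_elt_comm // subnn scale1r.
  by move: wE; rewrite EE => /eqP ->; rewrite linearZ.
- rewrite memv_cap /= => /andP[wE _].
  have [a ->] := coefX g i i r; have [b ->] := coefX g' j j r'.
  by apply: coef_diag_comm; apply: raise0.
rewrite memv_cap => /andP[zE zP] [z0 zev]; exists p, z; split=> // g i.
  by move=> j r ij; have [a ->] := coefX g i j r; apply: raise0.
by move=> r; apply: zev (g, i, r).
Qed.

Lemma diag0_eigenvalues i v (x y : C) : v != 0 ->
  act (X false i i 0) v = x *: v -> act (X true i i 0) v = y *: v -> x * y = 1.
Proof.
move=> v0 ex ey; have := coef_00VK i v.
rewrite !coef_0E ex linearZ /= ey scalerA -{2}[v]scale1r => /eqP.
rewrite -subr_eq0 -scalerBl scaler_eq0 (negPf v0) orbF subr_eq0.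
by move=> /eqP.
Qed.

End Representation.

(** * Superalgebra grading, cyclicity and the conclusion *)

Section QuantumAffine.
Variables (C : numClosedFieldType) (N : nat) (s : N.-tuple bool) (q : C).
Variables (V : vectType C) (rho : superrep s q V).

Local Notation gens := (@free_gen C N).
Local Notation alg := {malg C[{fmonom (bool * ('I_N * 'I_N) * nat)%type}]}.
Local Notation Rel := (relator s q gens).
Local Notation act x := (rep_act rho (to_quot Rel x)).

Lemma Uq_homog_gen g (i j : 'I_N) r :
  Uq_homog (tnth s i (+) tnth s j) (to_quot Rel (gens g i j r)).
Proof.
exists (gens g i j r) => // m; rewrite mcoeffU1.
case: (fmu _ =P m) => [<- _|_ /eqP //].
by rewrite /mon_parity fmU big_seq1.
Qed.

(** The monomials of a representative in the free algebra are sorted by parity. *)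
Lemma Uq_homog_split (x : Uq s q) : exists x0 x1,
  [/\ Uq_homog false x0, Uq_homog true x1 & x = x0 + x1].
Proof.
elim/quot_ind: x => f.
pose part p : alg := \sum_(m <- msupp f | mon_parity s m == p) << f@_m *g m >>.
have partP p : Uq_homog p (to_quot Rel (part p)).
  exists (part p) => // m; rewrite /part raddf_sum /=.
  apply: contraNeq => mp; rewrite big1 // => m' /eqP m'p.
  rewrite mcoeffU; case: eqP => // e; by rewrite -m'p e eqxx in mp.
exists (to_quot Rel (part false)), (to_quot Rel (part true)); split=> //.
rewrite -to_quotD; congr to_quot.
rewrite [LHS]monalgE /part (bigID (fun m => mon_parity s m == false)) /=.
by congr (_ + _); apply: eq_bigl => m; case: (mon_parity s m).
Qed.

(** The orbit of [z] is a nonzero subrepresentation. It is graded because [z] is homogeneous and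
    every algebra element splits into homogeneous parts. *)
Lemma irreducible_cyclic p (z : V) : irreducible_rep rho ->
  z \in rep_part rho p -> z != 0 -> forall v, exists x, v = rep_act rho x z.
Proof.
move=> [_ irr] zp z0.
have [|a u v [x ->] [y ->]|W WP] := @lin_pred_vspace _ V
    (fun v => exists x, v = rep_act rho x z).
- by exists 0; rewrite linear0 zero_lfunE.
- by exists (a *: x + y); rewrite linearP add_lfunE scale_lfunE.
have zW : z \in W by apply/WP; exists 1; rewrite rep_act1 id_lfunE.
have [|W0|Wfull] := irr W; last by move=> v; apply/WP; rewrite Wfull memvf.
  split; last first.
    move=> x; apply/subvP => _ /memv_imgP[_ /WP[y ->] ->].
    by apply/WP; exists (x * y); rewrite rep_actM comp_lfunE.
  apply/eqP; rewrite eqEsubv subv_add !capvSl !andbT.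
  apply/subvP => _ /WP[x ->].
  have [x0 [x1 [h0 h1 ->]]] := Uq_homog_split x.
  rewrite linearD add_lfunE.
  have W' p' y : Uq_homog p' y ->
      rep_act rho y z \in (W :&: rep_part rho (p' (+) p))%VS.
    move=> hy; rewrite memv_cap; apply/andP; split; first by apply/WP; exists y.
    by apply: (subvP (rep_parity rho p hy)); apply: memv_img.
  move: (W' _ _ h0) (W' _ _ h1); case: (p) => /= m0 m1; last exact: memv_add.
  by rewrite addrC; apply: memv_add.
by move: zW z0; rewrite W0 memv0 => /eqP ->; rewrite eqxx.
Qed.

Lemma irreducible_highest_weight :
    q != 0 -> (forall k, (0 < k)%N -> ~~ k.-unity_root q) ->
  irreducible_rep rho -> highest_weight_rep rho.
Proof.
move=> q0 q1 irr; have [V0 _] := irr.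
(* The action is pulled back to the free algebra, where the relators are actual elements, acting by
   zero. *)
pose f (x : alg) := act x.
have fD x y v : f (x + y) v = f x v + f y v.
  by rewrite /f to_quotD linearD add_lfunE.
have fZ c x v : f (c *: x) v = c *: f x v.
  by rewrite /f to_quotZ linearZ scale_lfunE.
have f1 v : f 1 v = v by rewrite /f to_quot1 rep_act1 id_lfunE.
have fM x y v : f (x * y) v = f x (f y v).
  by rewrite /f to_quotM rep_actM comp_lfunE.
have frel x v : Rel x -> f x v = 0.
  move=> rx; have -> : f x = f 0; last first.
    by rewrite /f to_quot0 linear0 zero_lfunE.
  by congr (rep_act rho _); apply/to_quotP; rewrite subr0; apply: ideal_gen.
have Vneq0 : fullv != 0%VS :> {vspace V} by apply/eqP.
have Xeven g i r p v :
    v \in rep_part rho p -> f (gens g i i r) v \in rep_part rho p.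
  move=> vp; have := Uq_homog_gen g i i r; rewrite addbb => h.
  by apply: (subvP (rep_parity rho p h)); apply: memv_img.
have [p [z [zp z0 zr zd]]] := highest_vector q0 fD fZ f1 fM frel q1 Vneq0
  (rep_part_full rho) (rep_part_direct rho) Xeven.
have [lam lamP] :
    exists lam, forall g i r, f (gens g i i r) z = lam g i r *: z.
  exists (fun g i r => sval (cid (zd g i r))) => g i r.
  by case: cid.
exists z, (lam false), (lam true); split.
- exact/eqP.
- exact: irreducible_cyclic irr zp z0.
- by move=> i j r ij; split; [apply: (zr false)|apply: (zr true)].
- by move=> i r; split; apply: lamP.
by move=> i; apply: (diag0_eigenvalues fD fZ f1 fM frel z0); apply: lamP.
Qed.

End QuantumAffine.

Theorem proposition5p2 (R : realType) (q : R[i]) (m n : nat)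
    (s : (m + n).-tuple bool) (V : vectType R[i]) (rho : superrep s q V) :
  q != 0 -> (forall k, (0 < k)%N -> ~~ k.-unity_root q) ->
  (2 <= m + n)%N -> s \in parity_seqs m n ->
  irreducible_rep rho -> highest_weight_rep rho.
Proof. by move=> q0 q1 _ _; apply: irreducible_highest_weight. Qed.
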